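(* Let $k\ge 1$ be an integer and let $(\alpha_1,\dots,\alpha_k)\in(0,\pi)^k$. For every finite set $E\subset\mathbb{R}^2$ of $n$ points (with $n$ large), $$|\Lambda_k(E;\alpha_1,\dots,\alpha_k)|\lesssim \begin{cases} n^{\frac{k-1}{2}+2}\log n, & k \text{ odd},\\ n^{\frac{k}{2}+2}, & k\text{ even}.\end{cases}$$
   Context: For points $x,y,z$ with $x\ne y\ne z$, $\angle(x,y,z)\in[0,\pi]$ denotes the angle at $y$ between the vectors $x-y$ and $z-y$. Given a finite set $E$ and angles $(\alpha_1,\dots,\alpha_k)$, a $k$-chain of type $(\alpha_1,\dots,\alpha_k)$ is a tuple $(x_1,\dots,x_{k+2})$ with $\angle(x_j,x_{j+1},x_{j+2})=\alpha_j$ for all $1\le j\le k$, and $\Lambda_k(E;\alpha_1,\dots,\alpha_k)$ is the set of such tuples in $E^{k+2}$. $X(n)\lesssim Y(n)$ means there are constants $C,N$ independent of $n$ (they may depend on $k$ and the angles) with $X(n)\le CY(n)$ for all $n>N$. *)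

(* Defs.v *)
From mathcomp Require Import all_boot all_order all_algebra finmap.
From mathcomp Require Import reals trigo.
Set Implicit Arguments.
Unset Strict Implicit.
Unset Printing Implicit Defensive.
Import Order.TTheory GRing.Theory Num.Theory.
Local Open Scope ring_scope.

Definition dot (R : realType) (u v : 'rV[R]_2) : R :=
  \sum_(i < 2) u 0 i * v 0 i.

(* The library's norm on row vectors is the sup norm, hence this definition. *)
Definition eucl_norm (R : realType) (u : 'rV[R]_2) : R := Num.sqrt (dot u u).

(* Meaningful only when x != y and y != z. *)
Definition angle (R : realType) (x y z : 'rV[R]_2) : R :=
  acos (dot (x - y) (z - y) / (eucl_norm (x - y) * eucl_norm (z - y))).

(* Indices start at 0. For j < k the three [inord]s are exactly j, j + 1, j + 2
   in 'I_k.+2. The disequalities are needed because [angle] takes the value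
   pi / 2 on degenerate triples. *)
Definition is_chain (R : realType) (k : nat) (alpha : 'I_k -> R)
    (x : 'I_k.+2 -> 'rV[R]_2) : bool :=
  [forall j : 'I_k,
    [&& x (inord j) != x (inord j.+1),
        x (inord j.+1) != x (inord j.+2)
      & angle (x (inord j)) (x (inord j.+1)) (x (inord j.+2)) == alpha j]].

Definition Lambda (R : realType) (k : nat) (E : {fset 'rV[R]_2})
    (alpha : 'I_k -> R) : {set {ffun 'I_k.+2 -> E}} :=
  [set x : {ffun 'I_k.+2 -> E} | is_chain alpha (fun i => val (x i))].

(* Main.v *)
Require Import Defs.
From mathcomp Require Import all_boot all_order all_algebra finmap.
From mathcomp Require Import reals exp trigo.
From mathcomp Require Import ring lra zify.
Set Implicit Arguments.
Unset Strict Implicit.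
Unset Printing Implicit Defensive.
Import Order.TTheory GRing.Theory Num.Theory.
Local Open Scope ring_scope.

(** Adding two points y, z to a chain ending in w, x multiplies the number of
chains by O(n): the angle at x confines y to two lines through x, and on such a
line z and the angle at y leave at most two positions for y. So it suffices to
treat chains with no angle, of which there are n^2, and with one angle.

For one angle (Pach and Sharir), call m the larger number of points on the two
lines carrying the sides of the angle. If m^2 > n, then this line, the point on
the other side and the point on this side determine the triple up to O(1)
choices, and the lines with more than sqrt n points have O(n) incidences.
Otherwise the pair on this line leaves O(m) choices for the third point, which
gives a sum of |l|^3 over the lines with at most sqrt n points; since O(n^2/t^3)
lines contain t points or more when t^2 <= n, it is O(n^2 log n). Both bounds on
lines follow from the Szemeredi-Trotter argument of Szekely: the crossing lemma
for the graph of consecutive points on lines. *)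

(** * Non-crossing segments *)

(** Choosing a related element for each [x] is injective. The relational form lets later counts name
    a code by its properties. *)
Lemma leq_card_rel (T U : finType) (A : {set T}) (B : {set U})
    (r : T -> U -> bool) :
  (forall x, x \in A -> exists2 y, y \in B & r x y) ->
  (forall x x' y, x \in A -> x' \in A -> r x y -> r x' y -> x = x') ->
  (#|A| <= #|B|)%N.
Proof.
move=> rex rinj.
have [->|[x0 x0A]] := set_0Vmem A; first by rewrite cards0.
have [y0 _ _] := rex _ x0A.
pose f x := odflt y0 [pick y in B | r x y].
have fP x : x \in A -> f x \in B /\ r x (f x).
  move=> xA; rewrite /f; case: pickP => [y /andP[]//|no].
  by have [y yB rxy] := rex _ xA; move: (no y); rewrite /= yB rxy.
rewrite -(card_in_imset (f := f) (D := mem A)).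
  by apply/subset_leq_card/subsetP => _ /imsetP[x xA ->]; case: (fP x xA).
move=> x x' xA x'A fxx'; have [_ r1] := fP x xA; have [_ r2] := fP x' x'A.
by apply: (rinj x x' (f x)) => //; rewrite fxx'.
Qed.

Section PlaneGraph.
Variables (R : realFieldType) (V : finType) (X Y : V -> R).
Hypothesis X_inj : injective X.

Definition slope (e : V * V) : R := (Y e.2 - Y e.1) / (X e.2 - X e.1).

Definition height (e : V * V) (t : R) : R := Y e.1 + slope e * (t - X e.1).

Definition gap (e f : V * V) (t : R) : R := height e t - height f t.

(** For edges directed to the right, [l] and [h] bound the common range of abscissae. The gap must
    have strictly opposite signs at the two ends, so touching there is no crossing. *)
Definition crossing (e f : V * V) : bool :=
  let l := Num.max (X e.1) (X f.1) in let h := Num.min (X e.2) (X f.2) in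
  (l < h) && (gap e f l * gap e f h < 0).

Lemma height1 e : height e (X e.1) = Y e.1.
Proof. by rewrite /height subrr mulr0 addr0. Qed.

Lemma height2 e : X e.1 < X e.2 -> height e (X e.2) = Y e.2.
Proof.
move=> lt_e; rewrite /height /slope divfK ?subr_eq0 ?gt_eqF//.
by rewrite addrC subrK.
Qed.

Lemma gap_affine e f s t :
  gap e f t = gap e f s + (slope e - slope f) * (t - s).
Proof. by rewrite /gap /height; ring. Qed.

(** A sign change makes an affine function strictly monotone, so its signs persist when the interval
    grows. *)
Lemma affine_sign_change (g k l s t h : R) :
  l <= s -> s < t -> t <= h -> g * (g + k * (t - s)) < 0 ->
  (g + k * (l - s)) * (g + k * (h - s)) < 0.
Proof.
move=> ls st th gt0.
have [g0|g0|g0] := ltgtP g 0; last by rewrite g0 mul0r ltxx in gt0.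
- have k1 : 0 < g + k * (t - s) by rewrite nmulr_rlt0 in gt0.
  have k0 : 0 < k by nra.
  have : g + k * (l - s) < 0 by nra.
  have : 0 < g + k * (h - s) by nra.
  by move=> *; rewrite nmulr_rlt0.
- have k1 : g + k * (t - s) < 0 by rewrite pmulr_rlt0 in gt0.
  have k0 : k < 0 by nra.
  have : 0 < g + k * (l - s) by nra.
  have : g + k * (h - s) < 0 by nra.
  by move=> *; rewrite pmulr_rlt0.
Qed.

Lemma crossingI e f s t :
  X e.1 <= s -> X f.1 <= s -> s < t -> t <= X e.2 -> t <= X f.2 ->
  gap e f s * gap e f t < 0 -> crossing e f.
Proof.
move=> es fs st te tf; rewrite /crossing.
set l := Num.max _ _; set h := Num.min _ _.
have ls : l <= s by rewrite ge_max es fs.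
have th : t <= h by rewrite le_min te tf.
rewrite (gap_affine _ _ s t) (gap_affine _ _ s l) (gap_affine _ _ s h) => g0.
rewrite (le_lt_trans ls (lt_le_trans st th)) /=.
exact: affine_sign_change g0.
Qed.

Section PlanarBound.
Variables (S : {set V}) (F : {set V * V}).
Hypothesis F_edge : forall e, e \in F -> [/\ e.1 \in S, e.2 \in S & X e.1 < X e.2].
Hypothesis F_empty : forall e w, e \in F -> w \in S ->
  X e.1 < X w -> X w < X e.2 -> height e (X w) != Y w.
Hypothesis F_planar : forall e f, e \in F -> f \in F -> ~~ crossing e f.

Let next (e e' : V * V) :=
  [&& e' \in F, e'.1 == e.1, slope e < slope e'
    & [forall f in F, (f.1 == e.1) && (slope e < slope f) ==>
                      (slope e' <= slope f)]].

Let in_wedge (e e' : V * V) (w : V) :=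
  [&& w \in S, X e.1 < X w, X w <= X e.2, X w <= X e'.2,
      height e (X w) <= Y w & Y w <= height e' (X w)].

Let hits (e e' : V * V) (w : V) :=
  in_wedge e e' w && [forall u, in_wedge e e' u ==> (X w <= X u)].

(** Otherwise the nearer right end would lie inside the longer edge, against [F_empty]. *)
Let same_slope e f : e \in F -> f \in F -> e.1 = f.1 -> slope e = slope f ->
  e = f.
Proof.
wlog lt_ef : e f / X e.2 <= X f.2.
  move=> W eF fF; case: (leP (X e.2) (X f.2)) => [/W|/ltW/W]; first by apply.
  by move=> W' e1 es; rewrite (W' fF eF).
move=> eF fF e1 es; have [_ e2S lte] := F_edge eF.
case: (ltgtP (X e.2) (X f.2)) lt_ef => // [lt_ef _|/X_inj e2 _].
  have lt_f1e2 : X f.1 < X e.2 by rewrite -e1.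
  have /eqP[] := F_empty fF e2S lt_f1e2 lt_ef.
  by rewrite -(height2 lte) /height e1 es.
by case: e f e1 e2 {eF fF es e2S lte} => ? ? [? ?] /= -> ->.
Qed.

Let height_lt e e' t : next e e' -> X e.1 < t -> height e t < height e' t.
Proof.
by case/and4P=> _ /eqP e1 es _ lt; rewrite /height e1 ltrD2l ltr_pM2r// subr_gt0.
Qed.

(** The right end that comes first lies in the wedge. *)
Let next_hits e e' : e \in F -> next e e' -> exists w, hits e e' w.
Proof.
move=> eF nx; have /and4P[e'F /eqP e1 es _] := nx.
have [_ e2S lte] := F_edge eF; have [_ e2S' lte'] := F_edge e'F.
have [w0 w0P] : exists w, in_wedge e e' w.
  have [le|/ltW le] := leP (X e.2) (X e'.2).
    exists e.2; rewrite /in_wedge e2S lte lexx le height2// lexx /=.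
    by rewrite -(height2 lte) ltW// height_lt.
  exists e'.2; rewrite /in_wedge e2S' -e1 lte' lexx le [height e' _]height2//.
  by rewrite lexx andbT /= -(height2 lte') ltW// height_lt// -e1.
have [w wP wmin] := arg_minP X w0P.
by exists w; rewrite /hits wP; apply/forallP => u; apply/implyP/wmin.
Qed.

(* If [v = e.1] lies right of [f.1], then it is outside the wedge of [f], which
   reaches past [v]; so an edge bounding one wedge would have to cross an edge
   bounding the other in order for both wedges to reach [w]. *)
Let hits_inj e e' f f' w : e \in F -> f \in F -> next e e' -> next f f' ->
  hits e e' w -> hits f f' w ->
  height e (X w) < height f' (X w) -> height f (X w) < height e' (X w) -> e = f.
Proof.
wlog le_fe : e e' f f' / X f.1 <= X e.1.
  move=> W eF fF ne nf he hf ef' fe'.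
  have [le|/ltW le] := leP (X f.1) (X e.1); first exact: (W e e' f f').
  by apply/esym; apply: (W f f' e e').
move=> eF fF ne nf he hf ef' fe'.
have /and4P[e'F /eqP e'1 es /forall_inP emin] := ne.
have /and4P[f'F /eqP f'1 fs /forall_inP fmin] := nf.
have /andP[/and5P[wS ew we2 we'2 _] _] := he.
have /andP[/and5P[_ fw wf2 wf'2 _] /forallP wmin] := hf.
case: (ltgtP (X f.1) (X e.1)) le_fe => // [lt_fe _|/X_inj ef1 _].
  have := wmin e.1; rewrite leNgt ew implybF /in_wedge.
  have [-> _ _] := F_edge eF.
  rewrite lt_fe (ltW (lt_le_trans ew wf2)) (ltW (lt_le_trans ew wf'2)) /=.
  rewrite negb_and -!ltNge => /orP[below|above].
  - have /negP[] := F_planar e'F fF.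
    apply: (@crossingI _ _ (X e.1) (X w)); rewrite ?e'1// ?(ltW lt_fe)//.
    by rewrite /gap -{1}e'1 height1 e'1 nmulr_rlt0 ?subr_lt0// subr_gt0.
  - have /negP[] := F_planar eF f'F.
    apply: (@crossingI _ _ (X e.1) (X w)); rewrite ?f'1// ?(ltW lt_fe)//.
    by rewrite /gap height1 pmulr_rlt0 ?subr_gt0// subr_lt0.
have lt0 : 0 < X w - X e.1 by rewrite subr_gt0.
have {}ef' : slope e < slope f'.
  by move: ef'; rewrite /height f'1 ef1 ltrD2l ltr_pM2r.
have {}fe' : slope f < slope e'.
  by move: fe'; rewrite /height e'1 ef1 ltrD2l ltr_pM2r.
apply: same_slope => //; case: (ltgtP (slope e) (slope f)) => // lt.
- have := emin f fF; rewrite ef1 eqxx lt /= => h.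
  by have := lt_le_trans fe' h; rewrite ltxx.
- have := fmin e eF; rewrite ef1 eqxx lt /= => h.
  by have := lt_le_trans ef' h; rewrite ltxx.
Qed.

(* Sweep rightwards through the wedge between an edge and the next steeper edge
   with the same left end, and charge the lower edge to the first point met.
   Each point is charged at most twice: once by a wedge in which it lies strictly
   below the upper edge, once by a wedge in which it lies strictly above the
   lower edge. *)
Lemma planar_edge_bound : (#|F| <= 3 * #|S|)%N.
Proof.
(* An edge with no next steeper one is charged to its left end; this is the third multiple of
   [#|S|]. *)
pose steepest := [set e in F | [forall e', ~~ next e e']].
pose below e w := [exists e', [&& next e e', hits e e' w & Y w < height e' (X w)]].
pose above e w := [exists e', [&& next e e', hits e e' w & height e (X w) < Y w]].
pose FB := [set e in F | [exists w, below e w]].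
pose FA := [set e in F | [exists w, above e w]].
have cover : F \subset steepest :|: (FB :|: FA).
  apply/subsetP => e eF; rewrite !inE eF /=.
  case: (boolP [forall e', ~~ next e e']) => //=.
  rewrite negb_forall => /existsP[e']; rewrite negbK => ne.
  have [w hw] := next_hits eF ne.
  have /andP[/and5P[_ ew _ _ _] _] := hw.
  have [lt|le] := ltP (Y w) (height e' (X w)).
    apply/orP; left; apply/existsP; exists w; apply/existsP; exists e'.
    by rewrite ne hw.
  apply/orP; right; apply/existsP; exists w; apply/existsP; exists e'.
  by rewrite ne hw /= (lt_le_trans _ le)// height_lt.
have c1 : (#|steepest| <= #|S|)%N.
  apply: (@leq_card_rel _ _ _ _ (fun e v => e.1 == v)) => [e|e f v].
    by rewrite inE => /andP[/F_edge[e1S _ _] _]; exists e.1.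
  rewrite !inE => /andP[eF /forallP ne] /andP[fF /forallP nf] /eqP e1 /eqP f1.
  have ef1 : e.1 = f.1 by rewrite e1 f1.
  apply: same_slope => //.
  have no_next g h : g \in F -> h \in F -> g.1 = h.1 ->
      (forall g', ~~ next g g') -> slope g < slope h -> False.
    move=> gF hF gh1 ng lt.
    pose P k := [&& k \in F, k.1 == g.1 & slope g < slope k].
    have Ph : P h by rewrite /P hF gh1 eqxx.
    have [g' /and3P[g'F g'1 g's] gmin] := arg_minP slope Ph.
    have /negP := ng g'; apply.
    rewrite /next g'F g'1 g's /=; apply/forall_inP => k kF.
    by apply/implyP => /andP[k1 ks]; apply: gmin; rewrite /P kF k1.
  case: (ltgtP (slope e) (slope f)) => // lt; first by case: (no_next e f).
  by case: (no_next f e).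
have c2 : (#|FB| <= #|S|)%N.
  apply: (@leq_card_rel _ _ _ _ below) => [e|e f w].
    rewrite inE => /andP[eF /existsP[w bw]]; exists w => //.
    by move: bw => /existsP[e' /and3P[_ /andP[/andP[]]]].
  rewrite !inE => /andP[eF _] /andP[fF _] /existsP[e' /and3P[ne he we]].
  move=> /existsP[f' /and3P[nf hf wf]].
  have /andP[/and5P[_ _ _ _ /andP[ew _]] _] := he.
  have /andP[/and5P[_ _ _ _ /andP[fw _]] _] := hf.
  by apply: (hits_inj eF fF ne nf he hf); [apply: le_lt_trans wf|apply: le_lt_trans we].
have c3 : (#|FA| <= #|S|)%N.
  apply: (@leq_card_rel _ _ _ _ above) => [e|e f w].
    rewrite inE => /andP[eF /existsP[w bw]]; exists w => //.
    by move: bw => /existsP[e' /and3P[_ /andP[/andP[]]]].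
  rewrite !inE => /andP[eF _] /andP[fF _] /existsP[e' /and3P[ne he we]].
  move=> /existsP[f' /and3P[nf hf wf]].
  have /andP[/and5P[_ _ _ _ /andP[_ ew]] _] := he.
  have /andP[/and5P[_ _ _ _ /andP[_ fw]] _] := hf.
  by apply: (hits_inj eF fF ne nf he hf); [apply: lt_le_trans fw|apply: lt_le_trans ew].
have := subset_leq_card cover.
have := (leq_card_setU steepest (FB :|: FA)).1; have := (leq_card_setU FB FA).1.
lia.
Qed.

End PlanarBound.

End PlaneGraph.

(** * The crossing lemma *)

Lemma sum_card_exchange (T U : finType) (A : {set U}) (P : T -> U -> bool) :
  (\sum_(c : T) #|[set x in A | P c x]| = \sum_(x in A) #|[set c | P c x]|)%N.
Proof.
under eq_bigr => c _ do rewrite -sum1dep_card big_mkcondr /=.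
rewrite exchange_big /=; apply: eq_bigr => x _.
by rewrite -big_mkcond /= sum1dep_card.
Qed.

(** A random colouring with [q.+1] colours gives [ord0] to all of [A] with probability 1 /
    [q.+1 ^ #|A|]; this is multiplied out to stay in the natural numbers. *)
Lemma card_ffun_fixed (T : finType) (q : nat) (A : {set T}) :
  (#|[set c : {ffun T -> 'I_q.+1} | [forall x in A, c x == ord0]]| * q.+1 ^ #|A|
   = q.+1 ^ #|T|)%N.
Proof.
pose P x : pred 'I_q.+1 := if x \in A then pred1 ord0 else predT.
have -> : #|[set c : {ffun T -> 'I_q.+1} | [forall x in A, c x == ord0]]| =
          #|family P|.
  apply: eq_card => c; rewrite inE; apply/forall_inP/familyP => cP x.
    by rewrite /P; case: ifP => // xA; rewrite inE cP.
  by move=> xA; have := cP x; rewrite /P xA.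
rewrite card_family foldrE big_image /= -prod_nat_const.
rewrite [X in (_ * X)%N]big_mkcond -big_split /= -[RHS]prod_nat_const.
apply: eq_bigr => x _; rewrite /P; case: (x \in A).
  by rewrite card1 mul1n.
by rewrite muln1 cardT size_enum_ord.
Qed.

Section CrossingLemma.
Variables (R : realFieldType) (V : finType) (X Y : V -> R).
Hypothesis X_inj : injective X.
Variable F : {set V * V}.
Hypothesis F_edge : forall e, e \in F -> X e.1 < X e.2.
Hypothesis F_empty : forall e w, e \in F ->
  X e.1 < X w -> X w < X e.2 -> height X Y e (X w) != Y w.

Let crossings (G : {set V * V}) :=
  [set p in setX G G | crossing X Y p.1 p.2].

Let edges_in (S : {set V}) := [set e in F | (e.1 \in S) && (e.2 \in S)].

(** Deleting all crossed edges leaves a plane graph, and each deleted edge is the first member of an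
    ordered crossing pair. *)
Let subgraph_bound (S : {set V}) :
  (#|edges_in S| <= 3 * #|S| + #|crossings (edges_in S)|)%N.
Proof.
set G := edges_in S.
pose crossed := [set e in G | [exists f in G, crossing X Y e f]].
have crossed_le : (#|crossed| <= #|crossings G|)%N.
  apply: leq_trans (leq_imset_card fst _); apply/subset_leq_card/subsetP => e.
  rewrite inE => /andP[eG /exists_inP[f fG cef]].
  by apply/imsetP; exists (e, f); rewrite // !inE /= in eG fG *; rewrite eG fG.
have : (#|G :\: crossed| <= 3 * #|S|)%N.
  apply: (planar_edge_bound X_inj (Y := Y)) => [e|e w|e f]; rewrite !inE.
  - by case/andP=> _ /andP[eF /andP[-> ->]]; split=> //; apply: F_edge.
  - by case/andP=> _ /andP[eF _] _; apply: F_empty.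
  - move=> /andP[+ eG] /andP[_ fG]; rewrite eG /= negb_exists => /forallP/(_ f).
    by rewrite !inE fG.
have : crossed \subset G by apply/subsetP => e; rewrite inE => /andP[].
move=> /setIidPr sub.
have := cardsID crossed G; rewrite sub; lia.
Qed.

(** At a common left or right end the gap would vanish, and a right end of one edge is no left end
    of the other because the ranges of abscissae overlap. *)
Let crossing_disjoint (e f : V * V) : e \in F -> f \in F -> crossing X Y e f ->
  #|[set e.1; e.2; f.1; f.2]| = 4.
Proof.
move=> /F_edge le /F_edge lf /andP[]; rewrite !(lt_min, gt_max).
move=> /andP[/andP[_ e1f2] /andP[f1e2 _]] g0.
have e1f1 : e.1 != f.1.
  apply: contraTneq g0 => e1; rewrite e1 maxxx.
  suff -> : gap X Y e f (X f.1) = 0 by rewrite mul0r ltxx.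
  by rewrite /gap height1 -e1 height1 e1 subrr.
have e2f2 : e.2 != f.2.
  apply: contraTneq g0 => e2; rewrite e2 minxx.
  suff -> : gap X Y e f (X f.2) = 0 by rewrite mulr0 ltxx.
  by rewrite /gap height2// -e2 height2// e2 subrr.
have neq (v w : V) : X v < X w -> v != w by apply: contraTneq => ->; rewrite ltxx.
rewrite !cardsU !cards1 !(setIUl, setIUr).
have I1 (v w : V) : v != w -> [set v] :&: [set w] = set0.
  move=> vw; apply/setP => x; rewrite !inE.
  by apply: contraNF vw => /andP[/eqP<- /eqP<-].
have e2f1 : e.2 != f.1 by rewrite eq_sym neq.
by rewrite !I1 ?(neq _ _ le, neq _ _ lf, neq _ _ f1e2)// !(setU0, cards0).
Qed.

(** Keep the vertices of colour [ord0] among [q] colours and sum [subgraph_bound] over all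
    colourings. Vertices, edges and crossings survive with probability 1/q, 1/q^2 and 1/q^4;
    multiply by q^4. *)
Lemma crossing_lemma_sampling (q : nat) : (0 < q)%N ->
  (#|F| * q ^ 2 <= 3 * #|V| * q ^ 3 + #|crossings F|)%N.
Proof.
case: q => // q _; set Q := q.+1.
pose zero (c : {ffun V -> 'I_Q}) := [set v | c v == ord0].
pose N (A : {set V}) :=
  #|[set c : {ffun V -> 'I_Q} | [forall x in A, c x == ord0]]|.
have NE (A : {set V}) : (N A * Q ^ #|A| = Q ^ #|V|)%N by exact: card_ffun_fixed.
have zeroE c (A : {set V}) :
    (A \subset zero c) = [forall x in A, c x == ord0].
  by apply/subsetP/forall_inP => h x /h; rewrite inE.
have edgesE : (\sum_c #|edges_in (zero c)| = \sum_(e in F) N [set e.1; e.2])%N.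
  rewrite sum_card_exchange; apply: eq_bigr => e _; apply: eq_card => c.
  by rewrite !inE -zeroE subUset !sub1set !inE.
have vertsE : (\sum_c #|zero c| = \sum_v N [set v])%N.
  transitivity (\sum_(c : {ffun V -> 'I_Q})
      #|[set v in [set: V] | c v == ord0]|)%N.
    by apply: eq_bigr => c _; apply: eq_card => v; rewrite !inE.
  rewrite sum_card_exchange; apply: eq_big => v; rewrite ?inE// => _.
  by apply: eq_card => c; rewrite !inE -zeroE sub1set inE.
have crossE : (\sum_c #|crossings (edges_in (zero c))| =
    \sum_(p in crossings F) N [set p.1.1; p.1.2; p.2.1; p.2.2])%N.
  transitivity (\sum_(c : {ffun V -> 'I_Q}) #|[set p in crossings F |
      [set p.1.1; p.1.2; p.2.1; p.2.2] \subset zero c]|)%N.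
    apply: eq_bigr => c _; apply: eq_card => p.
    rewrite !inE !subUset !sub1set !inE.
    case: (p.1 \in F); case: (p.2 \in F); rewrite ?andbF //=.
    by case: crossing; rewrite ?andbF ?andbT //= -!andbA.
  rewrite sum_card_exchange; apply: eq_bigr => p _; apply: eq_card => c.
  by rewrite !inE zeroE.
have := leq_sum (index_enum {ffun V -> 'I_Q}) (P := xpredT)
  (fun c _ => subgraph_bound (zero c)).
rewrite big_split /= -big_distrr /= edgesE vertsE crossE => main.
have eE : ((\sum_(e in F) N [set e.1; e.2]) * Q ^ 4 = #|F| * (Q ^ #|V| * Q ^ 2))%N.
  rewrite -sum_nat_const big_distrl /=; apply: eq_bigr => e /F_edge lt.
  have ne : e.1 != e.2 by apply: contraTneq lt => ->; rewrite ltxx.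
  by rewrite -(NE [set e.1; e.2]) cards2 ne -mulnA -expnD.
have vE : ((\sum_v N [set v]) * Q ^ 4 = #|V| * (Q ^ #|V| * Q ^ 3))%N.
  rewrite -sum_nat_const big_distrl /=; apply: eq_bigr => v _.
  by rewrite -(NE [set v]) cards1 -mulnA -expnD.
have cE : ((\sum_(p in crossings F) N [set p.1.1; p.1.2; p.2.1; p.2.2]) * Q ^ 4
           = #|crossings F| * Q ^ #|V|)%N.
  rewrite -sum_nat_const big_distrl /=; apply: eq_bigr => p.
  rewrite !inE => /andP[/andP[p1 p2] cp].
  by rewrite -(NE [set p.1.1; p.1.2; p.2.1; p.2.2]) crossing_disjoint.
have Q0 : (0 < Q ^ #|V|)%N by rewrite expn_gt0.
rewrite -(leq_pmul2r Q0).
rewrite -(leq_pmul2r (_ : 0 < Q ^ 4)%N) ?expn_gt0// in main.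
rewrite mulnDl eE -mulnA vE cE in main.
by move: main; congr (_ <= _)%N; ring.
Qed.

Lemma crossing_lemma :
  (#|F| <= 6 * #|V|)%N \/ (#|F| ^ 3 <= 288 * #|V| ^ 2 * #|crossings F|)%N.
Proof.
have [|lt] := leqP #|F| (6 * #|V|); first by left.
right; set n := #|V| in lt *; set e := #|F| in lt *.
have [n0|n0] := posnP n.
  have : (0 < e)%N by lia.
  rewrite /e card_gt0 => /set0Pn[[v w] _].
  by have : (0 < n)%N by [apply/card_gt0P; exists v]; rewrite n0.
(* With this q the vertex term 3 n q^3 is at most half of e q^2, so e q^2 is at most twice the
   number of crossings. As q >= 1, rounding down costs at most a factor 2: e <= 12 n q, and 288 = 2
   * 12^2. *)
pose q := (e %/ (6 * n))%N.
have n6 : (0 < 6 * n)%N by lia.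
have q0 : (0 < q)%N by rewrite divn_gt0// ltnW.
have qe : (q * (6 * n) <= e)%N by exact: leq_divM.
have eq2 : (e <= 12 * n * q)%N by have := ltn_ceil e n6; rewrite -/q; nia.
have := crossing_lemma_sampling q0; rewrite -/n -/e; set c := #|crossings F|.
move=> main.
have h1 : (e * q ^ 2 <= 2 * c)%N.
  have : (6 * n * q ^ 3 <= e * q ^ 2)%N.
    by rewrite expnS mulnA leq_mul2r [(6 * n * q)%N]mulnC qe orbT.
  lia.
have h2 : (e ^ 2 <= 144 * n ^ 2 * q ^ 2)%N.
  by rewrite -[144%N]/(12 ^ 2)%N -!expnMn leq_sqr.
have : (e * e ^ 2 <= 144 * n ^ 2 * (e * q ^ 2))%N.
  by rewrite mulnCA leq_mul2l h2 orbT.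
rewrite -expnS => h3; apply: leq_trans h3 _.
by rewrite (_ : 288 * n ^ 2 * c = 144 * n ^ 2 * (2 * c))%N ?leq_mul2l ?h1 ?orbT//; ring.
Qed.

End CrossingLemma.

(** * Incidences between points and lines *)

Section Lines.
Variables (R : realFieldType) (V : finType) (X Y : V -> R).

(** A line is encoded as the set of points of [V] on it, so that lines through different pairs can
    be compared and counted. An equation without division admits vertical lines. *)
Definition line (a b : V) : {set V} :=
  [set c | (X b - X a) * (Y c - Y a) == (Y b - Y a) * (X c - X a)].

Definition lines : {set {set V}} :=
  [set line p.1 p.2 | p in [set p : V * V | p.1 != p.2]].

Lemma line_in_lines a b : a != b -> line a b \in lines.
Proof. by move=> ab; apply/imsetP; exists (a, b); rewrite ?inE. Qed.

Lemma linesP l : l \in lines -> exists a b, a != b /\ l = line a b.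
Proof. by case/imsetP => -[a b]; rewrite inE => ab ->; exists a, b. Qed.

Lemma line_memL a b : a \in line a b.
Proof. by rewrite inE !subrr !mulr0. Qed.

Lemma line_memR a b : b \in line a b.
Proof. by rewrite inE mulrC. Qed.

Hypothesis XY_inj : forall v w, X v = X w -> Y v = Y w -> v = w.

Lemma lineP a b c : a != b ->
  reflect (exists t, X c = X a + t * (X b - X a) /\ Y c = Y a + t * (Y b - Y a))
          (c \in line a b).
Proof.
move=> ab; rewrite inE; apply: (iffP eqP) => [abc|[t [-> ->]]]; last by ring.
have [Xab|Xab] := eqVneq (X b - X a) 0.
  have Yab : Y b - Y a != 0.
    apply: contra_neq ab => Yab.
    by apply: XY_inj; apply/esym/eqP; rewrite -subr_eq0 ?Xab ?Yab.
  have Xca : X c - X a = 0.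
    by apply: (mulfI Yab); rewrite -abc Xab mul0r mulr0.
  exists ((Y c - Y a) / (Y b - Y a)); rewrite divfK// Xab mulr0 addr0.
  by split; lra.
exists ((X c - X a) / (X b - X a)); rewrite divfK//; split; first by ring.
rewrite mulrAC [(X c - X a) * _]mulrC -abc mulrAC mulfV// mul1r; ring.
Qed.

Lemma line_eq a b c d : a != b -> c \in line a b -> d \in line a b -> c != d ->
  line c d = line a b.
Proof.
move=> ab /(lineP _ ab)[s [Xc Yc]] /(lineP _ ab)[t [Xd Yd]] cd.
have st : t - s != 0.
  apply: contra_neq cd => /eqP; rewrite subr_eq0 => /eqP ts.
  by apply: XY_inj; rewrite ?Xc ?Xd ?Yc ?Yd ts.
apply/setP => w; rewrite !inE Xc Xd Yc Yd -subr_eq0 -[RHS]subr_eq0.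
set lhs := (X in X == 0); set rhs := (X in _ = (X == 0)).
have -> : lhs = (t - s) * rhs by rewrite /lhs /rhs; ring.
by rewrite mulf_eq0 (negbTE st).
Qed.

Lemma lines_eq l c d : l \in lines -> c \in l -> d \in l -> c != d ->
  line c d = l.
Proof. by move=> /linesP[a [b [ab ->]]]; apply: line_eq. Qed.

Lemma lines_gt1 l : l \in lines -> (1 < #|l|)%N.
Proof.
move=> /linesP[a [b [ab ->]]]; have := cards2 a b; rewrite ab => <-.
by apply/subset_leq_card; rewrite subUset !sub1set line_memL line_memR.
Qed.

End Lines.

(** * The incidence bound for points with distinct abscissae *)

Section IncidenceDistinctAbscissae.
Variables (R : realFieldType) (V : finType) (X Y : V -> R).
Hypothesis X_inj : injective X.
Variable L : {set {set V}}.
Hypothesis L_lines : L \subset lines X Y.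

Notation line := (line X Y).

Let XY_inj v w : X v = X w -> Y v = Y w -> v = w.
Proof. by move=> /X_inj. Qed.

Let edge_neq (e : V * V) : X e.1 < X e.2 -> e.1 != e.2.
Proof. by apply: contraTneq => ->; rewrite ltxx. Qed.

Lemma mem_line_height e c : X e.1 < X e.2 ->
  (c \in line e.1 e.2) = (height X Y e (X c) == Y c).
Proof.
move=> lte; have ne : X e.2 - X e.1 != 0 by rewrite subr_eq0 gt_eqF.
rewrite inE eq_sym -subr_eq0 -[RHS]subr_eq0.
set d := _ - _.
have -> : height X Y e (X c) - Y c = d / (X e.2 - X e.1).
  by rewrite /height /slope /d; field.
by rewrite mulf_eq0 invr_eq0 (negbTE ne) orbF.
Qed.

Lemma height_same_line e f : X e.1 < X e.2 -> X f.1 < X f.2 ->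
  line e.1 e.2 = line f.1 f.2 -> height X Y e =1 height X Y f.
Proof.
move=> lte ltf ef.
have f1 : height X Y e (X f.1) = Y f.1.
  by apply/eqP; rewrite -mem_line_height// ef line_memL.
have f2 : height X Y e (X f.2) = Y f.2.
  by apply/eqP; rewrite -mem_line_height// ef line_memR.
have sf : slope X Y f = slope X Y e.
  rewrite [LHS]/slope -f1 -f2 /height.
  have ne : X f.2 - X f.1 != 0 by rewrite subr_eq0 gt_eqF.
  by apply: (mulIf ne); rewrite divfK//; ring.
move=> t; rewrite [RHS]/height -f1 sf /height; ring.
Qed.

(** Equal gaps have the same zero, which each crossing has strictly inside its range. *)
Lemma crossing_overlap e f e' f' : gap X Y e f =1 gap X Y e' f' ->
  crossing X Y e f -> crossing X Y e' f' ->
  Num.max (X e'.1) (X f'.1) < Num.min (X e.2) (X f.2).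
Proof.
rewrite /crossing; set l := Num.max _ _; set h := Num.min _ _.
set l' := Num.max _ _; set h' := Num.min _ _ => eg /andP[lh glh] /andP[lh' glh'].
rewrite ltNge; apply/negP => hl'.
rewrite -!eg (gap_affine _ _ _ _ l l') (gap_affine _ _ _ _ l h') in glh'.
rewrite (gap_affine _ _ _ _ l h) in glh.
set g := gap _ _ _ _ _ in glh glh'; set k := _ - _ in glh glh'.
have [g0|g0|g0] := ltgtP g 0; last by rewrite g0 mul0r ltxx in glh.
- have gh : 0 < g + k * (h - l) by rewrite nmulr_rlt0 in glh.
  have k0 : 0 < k by nra.
  have a1 : 0 < g + k * (l' - l) by nra.
  have a2 : 0 < g + k * (h' - l) by nra.
  by rewrite ltNge ltW// mulr_gt0 in glh'.
- have gh : g + k * (h - l) < 0 by rewrite pmulr_rlt0 in glh.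
  have k0 : k < 0 by nra.
  have a1 : g + k * (l' - l) < 0 by nra.
  have a2 : g + k * (h' - l) < 0 by nra.
  by rewrite ltNge ltW// nmulr_rgt0 in glh'.
Qed.

Let F := [set e : V * V | [&& X e.1 < X e.2, line e.1 e.2 \in L
  & [forall w in line e.1 e.2, ~~ (X e.1 < X w < X e.2)]]].

(** Each point of [l] except the rightmost, [m], is the left end of the edge to its successor. *)
Let card_line_le (l : {set V}) : l \in L ->
  (#|l|.-1 <= #|[set e in F | line e.1 e.2 == l]|)%N.
Proof.
move=> lL; have ll := subsetP L_lines _ lL.
have [v0 v0l] : exists v, v \in l.
  by apply/card_gt0P; apply: leq_trans (lines_gt1 ll).
have [m ml mmax] : exists2 m, m \in l & forall v, v \in l -> X v <= X m.
  by have [m ml mmax] := arg_maxP X v0l; exists m.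
rewrite [#|l|](cardsD1 m) ml /=.
apply: (@leq_card_rel _ _ _ _ (fun v e => e.1 == v)) => [v|]; last first.
  by move=> v w e _ _ /eqP <- /eqP.
rewrite !inE => /andP[vm vl].
pose P w := (w \in l) && (X v < X w).
have Pm : P m.
  rewrite /P ml lt_neqAle (mmax v)// andbT.
  by apply: contra_neq vm => /X_inj.
have [w /andP[wl vw] wmin] := arg_minP X Pm.
have vwl : line v w = l by apply: (lines_eq XY_inj) => //; apply: edge_neq (v, w) vw.
exists (v, w) => //; rewrite !inE /= vw vwl lL eqxx andbT /=.
apply/forall_inP => u ul; apply/negP => /andP[vu].
by rewrite ltNge wmin// /P ul.
Qed.

(** Neither edge has an end of the other strictly inside it. *)
Let edge_overlap e f : e \in F -> f \in F -> line e.1 e.2 = line f.1 f.2 ->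
  X e.1 < X f.2 -> X f.1 < X e.2 -> e = f.
Proof.
rewrite !inE => /and3P[lte _ /forall_inP ee] /and3P[ltf _ /forall_inP ff] ef.
move=> e1f2 f1e2.
have := ee f.1; have := ee f.2; have := ff e.1; have := ff e.2.
rewrite ef line_memL line_memR -ef line_memL line_memR.
rewrite f1e2 e1f2 !andbT -!leNgt /=.
move=> /(_ isT) h1 /(_ isT) h2 /(_ isT) h3 /(_ isT) h4.
have e1 : e.1 = f.1 by apply/X_inj/le_anti; rewrite h2.
have e2 : e.2 = f.2 by apply/X_inj/le_anti; rewrite h1 h3.
by case: e f e1 e2 {h1 h2 h3 h4 ee ff lte ltf ef e1f2 f1e2} => ? ? [? ?] /= -> ->.
Qed.

Lemma incidence_bound_distinct_abscissae :
  (\sum_(l in L) #|l|.-1 <= 6 * #|V|)%N \/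
  ((\sum_(l in L) #|l|.-1) ^ 3 <= 288 * #|V| ^ 2 * #|L| ^ 2)%N.
Proof.
set I := (\sum_(l in L) _)%N.
have IF : (I <= #|F|)%N.
  rewrite -sum1_card (partition_big (fun e => line e.1 e.2) (mem L)) /=.
    apply: leq_sum => l lL; apply: leq_trans (card_line_le lL) _.
    by rewrite -sum1dep_card; under [leqRHS]eq_bigl do rewrite -topredE.
  by move=> e; rewrite inE => /and3P[].
have F_edge e : e \in F -> X e.1 < X e.2 by rewrite inE => /and3P[].
have F_empty e w : e \in F -> X e.1 < X w -> X w < X e.2 ->
    height X Y e (X w) != Y w.
  rewrite inE => /and3P[lte _ /forall_inP ee] w1 w2.
  by rewrite -mem_line_height//; apply: contraL w2 => /ee; rewrite w1.
(* By [crossing_overlap] and [edge_overlap] an ordered pair of lines carries at most one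
   crossing. *)
have crL : (#|[set p in setX F F | crossing X Y p.1 p.2]| <= #|L| ^ 2)%N.
  rewrite expnS expn1 -cardsX.
  apply: (@leq_card_rel _ _ _ _
    (fun p q => (line p.1.1 p.1.2 == q.1) && (line p.2.1 p.2.2 == q.2))).
    move=> [e f]; rewrite !inE /= => /andP[/andP[/and3P[_ eL _] /and3P[_ fL _]] _].
    by exists (line e.1 e.2, line f.1 f.2); rewrite ?inE /= ?eL ?fL ?eqxx.
  have crP e f : (e, f) \in [set p in setX F F | crossing X Y p.1 p.2] ->
      [/\ e \in F, f \in F & crossing X Y e f].
    by rewrite in_set in_setX => /andP[/andP[]].
  move=> [e f] [e' f'] [l m] /crP[eF fF cr] /crP[e'F f'F cr'] /=.
  move=> /andP[/eqP el /eqP fm] /andP[/eqP el' /eqP fm'].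
  have ee : line e.1 e.2 = line e'.1 e'.2 by rewrite el.
  have ff : line f.1 f.2 = line f'.1 f'.2 by rewrite fm.
  have gE : gap X Y e f =1 gap X Y e' f'.
    move=> t; rewrite /gap (height_same_line _ _ ee) ?F_edge//.
    by rewrite (height_same_line _ _ ff) ?F_edge.
  have := crossing_overlap gE cr cr'.
  have := crossing_overlap (fsym gE) cr' cr.
  rewrite !(lt_min, gt_max) => /andP[/andP[o1 _] /andP[_ o2]].
  move=> /andP[/andP[o3 _] /andP[_ o4]].
  by rewrite (edge_overlap eF e'F ee o1 o3) (edge_overlap fF f'F ff o2 o4).
have [h|h] := crossing_lemma X_inj F_edge F_empty.
  by left; apply: leq_trans h.
right; apply: leq_trans (_ : #|F| ^ 3 <= _)%N; first by rewrite leq_exp2r.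
by apply: leq_trans h _; rewrite leq_mul2l crL orbT.
Qed.

End IncidenceDistinctAbscissae.

(** * Arbitrary point sets: counting rich lines *)

Section Incidences.
Variables (R : realFieldType) (V : finType) (X Y : V -> R).
Hypothesis XY_inj : forall v w, X v = X w -> Y v = Y w -> v = w.

(** Two points with different ordinates get equal abscissae for only one [d]; the chosen [d] exceeds
    all these values. *)
Lemma exists_shear : exists d : R, injective (fun v => X v + d * Y v).
Proof.
pose r (p : V * V) := `|(X p.1 - X p.2) / (Y p.2 - Y p.1)|.
exists (1 + \sum_p r p) => v w; set d := 1 + _ => /eqP.
rewrite -subr_eq0 => /eqP vw.
have {}vw : X v - X w = d * (Y w - Y v) by lra.
have [Yvw|Yvw] := eqVneq (Y w - Y v) 0.
  apply: XY_inj; first by apply/eqP; rewrite -subr_eq0 vw Yvw mulr0.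
  by apply/esym/eqP; rewrite -subr_eq0 Yvw.
have : r (v, w) < d.
  rewrite /d (bigD1 (v, w)) //= addrCA ltrDl ltr_pwDl// sumr_ge0// => p _.
  exact: normr_ge0.
by rewrite /r /= vw mulfK// ltNge ler_norm.
Qed.

Lemma lines_shear d : lines (fun v => X v + d * Y v) Y = lines X Y.
Proof.
apply: eq_imset => -[a b] /=; apply/setP => c; rewrite !inE -subr_eq0.
rewrite -[RHS]subr_eq0; congr (_ == _); ring.
Qed.

Lemma incidence_bound (L : {set {set V}}) : L \subset lines X Y ->
  (\sum_(l in L) #|l|.-1 <= 6 * #|V|)%N \/
  ((\sum_(l in L) #|l|.-1) ^ 3 <= 288 * #|V| ^ 2 * #|L| ^ 2)%N.
Proof.
have [d d_inj] := exists_shear; rewrite -(lines_shear d).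
exact: incidence_bound_distinct_abscissae.
Qed.

Let double_pred l : l \in lines X Y -> (#|l| <= 2 * #|l|.-1)%N.
Proof. by move=> /lines_gt1; lia. Qed.

Let sum_card_rich (L : {set {set V}}) t : (forall l, l \in L -> t <= #|l|)%N ->
  (#|L| * t <= \sum_(l in L) #|l|)%N.
Proof. by move=> h; rewrite -sum_nat_const; apply: leq_sum. Qed.

Let sum_card_pred (L : {set {set V}}) : L \subset lines X Y ->
  (\sum_(l in L) #|l| <= 2 * \sum_(l in L) #|l|.-1)%N.
Proof.
move=> /subsetP LL; rewrite big_distrr; apply: leq_sum => l /LL.
exact: double_pred.
Qed.

(** [#|L| * t] is at most twice the sum in [incidence_bound]. In the linear alternative
    [t ^ 2 <= #|V|] supplies the missing factor; in the cubic one [#|L| ^ 2] cancels, and 2304 = 2^3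
    * 288. *)
Lemma card_rich_lines t : (t ^ 2 <= #|V|)%N ->
  (#|[set l in lines X Y | t <= #|l|]| * t ^ 3 <= 2304 * #|V| ^ 2)%N.
Proof.
set L := [set l in _ | _]; set n := #|V| => tn.
have LL : L \subset lines X Y by apply/subsetP => l; rewrite inE => /andP[].
have := sum_card_rich (L := L) (t := t) _; have := sum_card_pred LL.
set W := (\sum_(l in L) #|l|)%N; have := incidence_bound LL.
set I := (\sum_(l in L) #|l|.-1)%N; rewrite -/n => IL WI Wt.
have {Wt WI}LI : (#|L| * t <= 2 * I)%N.
  by apply: leq_trans WI; apply: Wt => l; rewrite inE => /andP[].
case: IL => IL.
  have h : (#|L| * t <= 12 * n)%N by lia.
  have := leq_mul h tn; rewrite -mulnA -expnS => h'.
  by apply: leq_trans h' _; nia.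
have [->|L0] := posnP #|L|; first by rewrite mul0n.
have L20 : (0 < #|L| ^ 2)%N by rewrite expn_gt0 L0.
rewrite -(leq_pmul2l L20) mulnA -expnSr -expnMn.
apply: leq_trans (_ : (2 * I) ^ 3 <= _)%N; first by rewrite leq_exp2r.
rewrite expnMn; apply: leq_trans (leq_mul (leqnn _) IL) _.
by rewrite [leqRHS]mulnC !mulnA leqnn.
Qed.

(** Each line has at least [s] points, [s] being least with [n < s ^ 2], so [#|L| ^ 2 * n <= W ^ 2].
    In the cubic alternative this eliminates [#|L|] from the bound on [W ^ 3], and [W ^ 2]
    cancels. *)
Lemma sum_card_very_rich_lines :
  (\sum_(l in lines X Y | #|V| < #|l| ^ 2) #|l| <= 2304 * #|V|)%N.
Proof.
pose L := [set l in lines X Y | (#|V| < #|l| ^ 2)%N].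
set n := #|V|; rewrite (eq_bigl (mem L)); last by move=> l; rewrite /= inE.
have LL : L \subset lines X Y by apply/subsetP => l; rewrite inE => /andP[].
have ex_s : exists s, (n < s ^ 2)%N.
  by exists n.+1; rewrite expnS expn1 mulnS leq_addr.
case: (ex_minnP ex_s) => s ns smin.
have := sum_card_rich (L := L) (t := s) _; have := sum_card_pred LL.
have := incidence_bound LL.
set W := (\sum_(l in L) #|l|)%N.
set I := (\sum_(l in L) #|l|.-1)%N; rewrite -/n => IL WI Ws.
have {}Ws : (#|L| * s <= W)%N.
  by apply: Ws => l; rewrite inE => /andP[_ ?]; apply: smin.
case: IL => IL; first by lia.
have WLn : (#|L| ^ 2 * n <= W ^ 2)%N.
  apply: leq_trans (_ : (#|L| * s) ^ 2 <= _)%N; last by rewrite leq_exp2r.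
  by rewrite expnMn leq_mul2l ltnW ?orbT.
have W3 : (W ^ 3 <= 2304 * n ^ 2 * #|L| ^ 2)%N.
  apply: leq_trans (_ : (2 * I) ^ 3 <= _)%N; first by rewrite leq_exp2r.
  rewrite expnMn; apply: leq_trans (leq_mul (leqnn _) IL) _.
  by rewrite !mulnA leqnn.
have [W0|W0] := posnP W; first by rewrite W0.
have [n0|n0] := posnP n.
  by move: W3; rewrite n0 muln0 mul0n leqNgt expn_gt0 W0.
have nW2 : (0 < n * W ^ 2)%N by rewrite muln_gt0 n0 expn_gt0 W0.
rewrite -(leq_pmul2l nW2) -mulnA -expnSr.
apply: leq_trans (leq_mul (leqnn n) W3) _.
rewrite (_ : n * (2304 * n ^ 2 * #|L| ^ 2) =
             2304 * n ^ 2 * (#|L| ^ 2 * n))%N; last ring.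
rewrite (_ : n * W ^ 2 * (2304 * n) = 2304 * n ^ 2 * W ^ 2)%N; last ring.
by rewrite leq_mul2l WLn orbT.
Qed.

(** Starting at t = 2, which suits lines with at least two points, later keeps the sum of 1 / t
    below the logarithm. *)
Lemma cube_le_sum_squares m : (1 < m)%N ->
  (m ^ 3 <= 4 * \sum_(2 <= t < m.+1) t ^ 2)%N.
Proof.
elim: m => // m IH; rewrite ltnS leq_eqVlt => /orP[/eqP <-|/[dup] m1 /IH{}IH].
  by rewrite big_nat1.
rewrite big_nat_recr //= ?mulnDr; last lia.
have : (m.+1 ^ 3 <= m ^ 3 + 4 * m.+1 ^ 2)%N by nia.
by move=> h; apply: leq_trans h _; rewrite leq_add2r.
Qed.

(** Layer-cake summation: a line contributes t^2 to every level t up to its size, and exchanging the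
    sums counts the lines at each level. *)
Lemma sum_cube_poor_lines :
  (\sum_(l in lines X Y | (#|l| ^ 2 <= #|V|)%N) #|l| ^ 3 <= 4 *
   \sum_(2 <= t < #|V|.+1)
     t ^ 2 * #|[set l in lines X Y | (t <= #|l|)%N & (#|l| ^ 2 <= #|V|)%N]|)%N.
Proof.
set n := #|V|.
apply: leq_trans (_ : \sum_(l in lines X Y | #|l| ^ 2 <= n)
  (4 * \sum_(2 <= t < n.+1 | t <= #|l|) t ^ 2) <= _)%N.
  apply: leq_sum => l /andP[/lines_gt1 l1 _].
  apply: leq_trans (cube_le_sum_squares l1) _.
  rewrite leq_mul2l /= (@big_cat_nat _ _ _ #|l|.+1 2 n.+1) /= ?ltnS ?max_card
    ?(ltnW l1)//.
  apply: leq_trans (leq_addr _ _).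
  rewrite big_nat_cond [leqRHS]big_nat_cond eq_leq//; apply: eq_bigl => t.
  by rewrite ltnS; case: (1 < t)%N; case: (_ <= _)%N.
rewrite -big_distrr /= leq_mul2l /= (exchange_big_dep xpredT) //=.
apply: leq_sum => t _; rewrite sum_nat_const mulnC leq_mul2l.
apply/orP; right; apply/subset_leq_card/subsetP => l.
by rewrite !inE => /andP[/andP[-> ->] ->].
Qed.

End Incidences.

Lemma sum_inv_le_ln (R : realType) n : (0 < n)%N ->
  \sum_(2 <= t < n.+1) (t%:R)^-1 <= ln n%:R :> R.
Proof.
elim: n => // -[_ _|n IH _]; first by rewrite big_geq// ln1.
rewrite big_nat_recr //=; have := IH isT.
suff : (n.+2%:R)^-1 <= ln n.+2%:R - ln n.+1%:R :> R.
  by move=> h S; apply: le_trans (lerD S h) _; rewrite addrC subrK.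
have n1 : 0 < n.+1%:R :> R by rewrite ltr0n.
have n2 : 0 < n.+2%:R :> R by rewrite ltr0n.
rewrite -lerN2 opprB -ln_div ?posrE//.
have -> : n.+1%:R / n.+2%:R = 1 + - n.+2%:R^-1 :> R.
  apply: (mulIf (lt0r_neq0 n2)); rewrite divfK ?lt0r_neq0// mulrDl mul1r mulNr.
  by rewrite mulVf ?lt0r_neq0// -[n.+2%:R]natr1 addrK.
by apply: le_ln1Dx; rewrite ltrN2 invf_lt1// ltr1n.
Qed.

(** * Triples with a given angle *)

Lemma card_slices (T U : finType) (A : {set T * U}) :
  (#|A| = \sum_x #|[set y | (x, y) \in A]|)%N.
Proof.
under eq_bigr do rewrite -sum1dep_card.
by rewrite pair_big_dep /= -sum1_card; apply: eq_bigl => -[].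
Qed.

Section Triples.
Variables (R : realFieldType) (V : finType) (X Y : V -> R).
Hypothesis XY_inj : forall v w, X v = X w -> Y v = Y w -> v = w.

Notation line := (line X Y).
Notation lines := (lines X Y).

(* The vector from [y] to [z] is parallel to the image of the vector from [y]
   to [x] under [c + s i], i.e. under a rotation up to scaling. *)
Definition turn (c s : R) (x y z : V) : bool :=
  [&& x != y, z != y &
    c * ((X x - X y) * (Y z - Y y) - (Y x - Y y) * (X z - X y)) ==
    s * ((X x - X y) * (X z - X y) + (Y x - Y y) * (Y z - Y y))].

Lemma turnC c s x y z : turn c s x y z = turn c (- s) z y x.
Proof.
rewrite /turn andbCA; congr [&& _, _ & _].
by rewrite -eqr_opp; congr (_ == _); ring.
Qed.

Lemma lineC a b : line a b = line b a.
Proof.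
apply/setP => c; rewrite !inE -subr_eq0 -[RHS]subr_eq0 -oppr_eq0.
congr (_ == _); ring.
Qed.

Let sqr_dist_gt0 v w : v != w -> 0 < (X v - X w) ^+ 2 + (Y v - Y w) ^+ 2.
Proof.
move=> vw; rewrite lt0r addr_ge0 ?sqr_ge0// andbT.
apply: contra_neq vw => /eqP.
rewrite paddr_eq0 ?sqr_ge0// !sqrf_eq0 !subr_eq0 => /andP[/eqP ? /eqP ?].
exact: XY_inj.
Qed.

Variables c s : R.
Hypothesis s0 : s != 0.

(** For fixed [x] and [y] the equation is linear in the vector (a, b) from [y] to [z]:
    [p * a = q * b], where p^2 + q^2 = (c^2 + s^2) |x - y|^2 is nonzero. Hence any two solutions are
    parallel. *)
Lemma turn_line x y z z' : turn c s x y z -> turn c s x y z' -> z' \in line z y.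
Proof.
move=> /and3P[xy zy /eqP t] /and3P[_ z'y /eqP t']; rewrite lineC inE.
have d0 := sqr_dist_gt0 xy; set u := X x - X y in t t' d0.
set v := Y x - Y y in t t' d0; set a := X z - X y in t *.
set b := Y z - Y y in t *; set a' := X z' - X y in t' *.
set b' := Y z' - Y y in t' *.
have p0 : (s * u + c * v) ^+ 2 + (c * u - s * v) ^+ 2 != 0.
  rewrite (_ : _ + _ = (c ^+ 2 + s ^+ 2) * (u ^+ 2 + v ^+ 2)); last by ring.
  rewrite mulf_neq0 ?(gt_eqF d0)// paddr_eq0 ?sqr_ge0//.
  by rewrite !sqrf_eq0 negb_and s0 orbT.
have e : (s * u + c * v) * a = (c * u - s * v) * b by lra.
have e' : (s * u + c * v) * a' = (c * u - s * v) * b' by lra.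
rewrite -subr_eq0 -(mulrI_eq0 _ (lregP p0)) mulrDl; apply/eqP.
set p := s * u + c * v in e e' *; set q := c * u - s * v in e e' *.
have -> : p ^+ 2 * (a * b' - b * a') = 0.
  transitivity (p * ((p * a) * b' - b * (p * a'))); first by ring.
  by rewrite e e'; ring.
have -> : q ^+ 2 * (a * b' - b * a') = 0; last by rewrite addr0.
transitivity (q * (a * (q * b') - (q * b) * a')); first by ring.
by rewrite -e -e'; ring.
Qed.

(** With [x] and [y] on [l], the direction (u, v) of [l] can replace x - y in the equation.
    Subtracting the equations for [y] and [y'] removes the term in [c] and leaves s (ty' - ty) (u^2
    + v^2) = 0. *)
Lemma turn_apex_inj l x y x' y' z : l \in lines ->
  x \in l -> y \in l -> x' \in l -> y' \in l ->
  turn c s x y z -> turn c s x' y' z -> y = y'.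
Proof.
move=> /linesP[a [b [ab ->]]] /(lineP XY_inj _ ab)[tx [Xx Yx]].
move=> /(lineP XY_inj _ ab)[ty [Xy Yy]] /(lineP XY_inj _ ab)[tx' [Xx' Yx']].
move=> /(lineP XY_inj _ ab)[ty' [Xy' Yy']].
have d0 := sqr_dist_gt0 ab; rewrite eq_sym in ab.
move=> /and3P[xy _ /eqP t] /and3P[xy' _ /eqP t'].
set u := X b - X a in Xx Yx Xy Yy Xx' Yx' Xy' Yy'.
set v := Y b - Y a in Xx Yx Xy Yy Xx' Yx' Xy' Yy'.
have txy : tx - ty != 0.
  by apply: contra_neq xy => /subr0_eq h; apply: XY_inj; rewrite ?Xx ?Yx ?Xy ?Yy h.
have txy' : tx' - ty' != 0.
  by apply: contra_neq xy' => /subr0_eq h; apply: XY_inj; rewrite ?Xx' ?Yx' ?Xy' ?Yy' h.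
have h : c * (u * (Y z - Y y) - v * (X z - X y)) =
         s * (u * (X z - X y) + v * (Y z - Y y)).
  have dX : X x - X y = (tx - ty) * u by rewrite Xx Xy; ring.
  have dY : Y x - Y y = (tx - ty) * v by rewrite Yx Yy; ring.
  by apply: (mulfI txy); rewrite dX dY in t; lra.
have h' : c * (u * (Y z - Y y') - v * (X z - X y')) =
         s * (u * (X z - X y') + v * (Y z - Y y')).
  have dX : X x' - X y' = (tx' - ty') * u by rewrite Xx' Xy'; ring.
  have dY : Y x' - Y y' = (tx' - ty') * v by rewrite Yx' Yy'; ring.
  by apply: (mulfI txy'); rewrite dX dY in t'; lra.
have : s * ((ty' - ty) * ((X a - X b) ^+ 2 + (Y a - Y b) ^+ 2)) = 0.
  rewrite Xy Yy in h; rewrite Xy' Yy' in h'.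
  rewrite -/u -/v (_ : (X a - X b) ^+ 2 + _ = u ^+ 2 + v ^+ 2); last first.
    by rewrite /u /v; ring.
  by lra.
move=> /eqP; rewrite mulf_eq0 (negbTE s0) mulf_eq0 (gt_eqF d0) orbF subr_eq0 /=.
by move=> /eqP e; apply: XY_inj; rewrite ?Xy ?Yy ?Xy' ?Yy' e.
Qed.

(** The first side lies on a line at least as rich as the second. By [turnC], the triples left out
    become such triples when reversed, with [- s] for [s]. *)
Let half := [set p : V * V * V | turn c s p.1.1 p.1.2 p.2 &
  (#|line p.2 p.1.2| <= #|line p.1.1 p.1.2|)%N].

Let rich (p : V * V) := (#|V| < #|line p.1 p.2| ^ 2)%N.

(** The line, [x] and [z] determine [y] by [turn_apex_inj], so a triple is coded by a point on a
    very rich line together with [z]. *)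
Let card_rich_half :
  (#|[set p in half | rich p.1]| <=
   (\sum_(l in lines | #|V| < #|l| ^ 2) #|l|) * #|V|)%N.
Proof.
pose A := [set q : {set V} * V |
  [&& q.1 \in lines, (#|V| < #|q.1| ^ 2)%N & q.2 \in q.1]].
apply: leq_trans (_ : #|setX A [set: V]| <= _)%N.
  apply: (@leq_card_rel _ _ _ _
    (fun p q => [&& line p.1.1 p.1.2 == q.1.1, p.1.1 == q.1.2 & p.2 == q.2])).
    move=> [[x y] z]; rewrite !inE /rich /= => /andP[/andP[/and3P[xy _ _] _] r].
    exists (line x y, x, z); rewrite ?eqxx// !inE r line_in_lines//=.
    by have := line_memL X Y x y; rewrite inE => ->.
  move=> [[x y] z] [[x' y'] z'] [[l x2] z2]; rewrite !inE /=.
  move=> /andP[/andP[t _] _] /andP[/andP[t' _] _].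
  move=> /and3P[/eqP <- /eqP <- /eqP <-] /and3P[/eqP e /eqP e1 /eqP e2].
  rewrite {}e1 {}e2 in t' e *.
  have /and3P[xy _ _] := t.
  rewrite (@turn_apex_inj _ x y x y' z (line_in_lines X Y xy))
    ?line_memL ?line_memR//.
  by rewrite -e line_memR.
rewrite cardsX cardsT leq_mul2r card_slices [leqRHS]big_mkcond leq_sum ?orbT// => l _.
case: ifPn => [/andP[ll lr]|lr].
  by apply/subset_leq_card/subsetP => v; rewrite !inE /= ll lr.
rewrite leqn0 cards_eq0; apply/eqP/setP => v; rewrite !inE /= andbA.
by rewrite (negbTE lr).
Qed.

(** For given [x] and [y] the points [z] lie on one line, with at most as many points as [line x y];
    a line [l] carries at most [#|l| ^ 2] pairs. *)
Let card_poor_half :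
  (#|[set p in half | ~~ rich p.1]| <=
   \sum_(l in lines | #|l| ^ 2 <= #|V|) #|l| ^ 3)%N.
Proof.
rewrite card_slices.
apply: leq_trans (_ : \sum_(p | (p.1 != p.2) && ~~ rich p) #|line p.1 p.2| <= _)%N.
  rewrite [leqRHS]big_mkcond; apply: leq_sum => -[x y] _; rewrite /=.
  set A := [set z | _].
  have [->|[z]] := set_0Vmem A; first by rewrite cards0.
  rewrite !inE /= => /andP[/andP[tz le] r].
  have /and3P[-> _ _] := tz; rewrite r /=.
  apply: leq_trans le; apply/subset_leq_card/subsetP => w.
  move=> wA; apply: (turn_line tz); move: wA.
  by rewrite !inE /= => /andP[/andP[]].
rewrite (partition_big (fun p => line p.1 p.2)
  (fun l => (l \in lines) && (#|l| ^ 2 <= #|V|)%N)) /=; last first.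
  by move=> p /andP[pp]; rewrite /rich -leqNgt => ->; rewrite line_in_lines.
apply: leq_sum => l _.
rewrite (eq_bigr (fun=> #|l|)); last by move=> p /andP[_ /eqP ->].
rewrite sum_nat_const expnSr leq_mul2r; apply/orP; right.
rewrite expnS expn1 -cardsX; apply/subset_leq_card/subsetP => -[x y].
by move=> /andP[_ /eqP <-]; rewrite in_setX /= line_memL line_memR.
Qed.

Lemma card_half_turn : (#|half| <=
  2304 * #|V| ^ 2 + \sum_(l in lines | #|l| ^ 2 <= #|V|) #|l| ^ 3)%N.
Proof.
rewrite -(cardsID [set p | rich p.1] half) leq_add//.
  apply: leq_trans (leq_trans card_rich_half _).
    by apply/subset_leq_card/subsetP => p; rewrite !inE.
  by rewrite expnSr mulnA leq_mul2r (sum_card_very_rich_lines XY_inj) orbT.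
apply: leq_trans card_poor_half.
by apply/subset_leq_card/subsetP => p; rewrite !inE andbC.
Qed.

End Triples.

(** * The logarithmic bound for triples with a given angle *)

Section AngleTriples.
Variables (R : realType) (V : finType) (X Y : V -> R).
Hypothesis XY_inj : forall v w, X v = X w -> Y v = Y w -> v = w.
Variables c s : R.
Hypothesis s0 : s != 0.

(** For [t ^ 2 <= n] level t contributes at most 2304 n^2 / t by [card_rich_lines]; for larger t no
    poor line has t points. Finally 9216 = 4 * 2304. *)
Lemma sum_cube_poor_lines_le_ln :
  (\sum_(l in lines X Y | (#|l| ^ 2 <= #|V|)%N) #|l| ^ 3)%:R <=
  9216 * (#|V|%:R ^+ 2 * ln #|V|%:R) :> R.
Proof.
set n := #|V|.
have [n0|n0] := posnP n.
  rewrite n0 (_ : (\sum_(l in lines X Y | _) _)%N = 0%N).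
    by rewrite expr0n mul0r mulr0.
  apply: big1 => l /andP[/lines_gt1 l1 _].
  by have := leq_trans l1 (max_card _); rewrite -/n n0.
apply: le_trans (_ : 4 * (2304 * n%:R ^+ 2 * \sum_(2 <= t < n.+1) t%:R^-1) <= _);
  last first.
  have := sum_inv_le_ln R n0; set S := bigop _ _ _ => Sl.
  rewrite mulrA [9216 * _]mulrA ler_pM// ?mulr_ge0 ?exprn_ge0//.
    by rewrite /S sumr_ge0// => t _; rewrite invr_ge0.
  by rewrite mulrA -natrM.
have := sum_cube_poor_lines X Y; rewrite -/n -(ler_nat R) => /le_trans; apply.
rewrite natrM ler_pM2l ?ltr0n// natr_sum mulr_sumr ler_sum_nat// => t /andP[t2 _].
set N := #|_|.
have t0 : 0 < t%:R :> R by rewrite ltr0n; lia.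
rewrite ler_pdivlMr// -natrM -natrX -natrM ler_nat.
have [tn|tn] := leqP (t ^ 2) n.
  apply: leq_trans (card_rich_lines XY_inj tn).
  rewrite mulnAC -expnSr mulnC leq_mul2r; apply/orP; right.
  by apply/subset_leq_card/subsetP => l; rewrite !inE => /and3P[-> ->].
rewrite (_ : N = 0%N) ?muln0 ?mul0n//; apply/eqP; rewrite cards_eq0.
apply/eqP/setP => l; rewrite !inE; apply/negP => /and3P[_ tl ln].
by move: (leq_ltn_trans ln tn); rewrite ltnNge leq_exp2r// tl.
Qed.

Lemma card_turn_triples : (1 < #|V|)%N ->
  #|[set p : V * V * V | turn X Y c s p.1.1 p.1.2 p.2 ||
                         turn X Y c (- s) p.1.1 p.1.2 p.2]|%:R <=
  4 * 13824 * (#|V|%:R ^+ 2 * ln #|V|%:R) :> R.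
Proof.
set n := #|V| => n1.
pose half t := [set p : V * V * V | turn X Y c t p.1.1 p.1.2 p.2 &
  (#|line X Y p.2 p.1.2| <= #|line X Y p.1.1 p.1.2|)%N].
have ns0 : - s != 0 by rewrite oppr_eq0.
(* As ln n >= ln 2 >= 1/2, the term 2304 n^2 is at most 4608 n^2 ln n, and 4608 + 9216 = 13824. *)
have ln1 : 1 <= 2 * ln n%:R :> R.
  have h2 : 2^-1 <= ln 2 :> R.
    by have := sum_inv_le_ln R (ltn0Sn 1); rewrite big_nat1.
  have : ln 2 <= ln n%:R :> R by rewrite ler_ln ?posrE ?ltr0n ?ler_nat//; lia.
  by lra.
have halfE t : t != 0 -> #|half t|%:R <= 13824 * (n%:R ^+ 2 * ln n%:R) :> R.
  move=> t0; have := card_half_turn XY_inj c t0; rewrite -(ler_nat R) => /le_trans.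
  apply; rewrite natrD natrM natrX -/n.
  have := sum_cube_poor_lines_le_ln; rewrite -/n; set W := (_ %:R) => hW.
  have n20 : 0 <= n%:R ^+ 2 :> R by rewrite exprn_ge0.
  have : n%:R ^+ 2 <= 2 * (n%:R ^+ 2 * ln n%:R) :> R by nra.
  by lra.
(* Reversal sends a triple outside [half t] into [half (- t)]. Over both signs each half occurs
   twice, hence the factor 4. *)
have swap t : (#|[set p : V * V * V | turn X Y c t p.1.1 p.1.2 p.2]| <=
    #|half t| + #|half (- t)|)%N.
  set A := [set p | _].
  rewrite -(cardsID (half t) A) leq_add//.
    by apply/subset_leq_card/subsetIr.
  apply: (@leq_card_rel _ _ _ _ (fun p q => q == (p.2, p.1.2, p.1.1))).
    move=> [[x y] z]; rewrite !inE /= => /andP[+ tz]; rewrite tz /= => le.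
    exists (z, y, x) => //; rewrite !inE /= -turnC tz /=.
    by move: le; rewrite -ltnNge => /ltnW.
  by move=> [[x y] z] [[x' y'] z'] q _ _ /eqP -> /eqP[-> -> ->].
set A := [set p | _].
have A4 : (#|A| <= 2 * (#|half s| + #|half (- s)|))%N.
  apply: leq_trans (_ : #|[set p : V * V * V | turn X Y c s p.1.1 p.1.2 p.2] :|:
    [set p : V * V * V | turn X Y c (- s) p.1.1 p.1.2 p.2]| <= _)%N.
    by apply/subset_leq_card/subsetP => p; rewrite !inE.
  apply: leq_trans (leq_card_setU _ _).1 _.
  rewrite mul2n -addnn leq_add ?swap//.
  by have := swap (- s); rewrite opprK addnC.
rewrite -(ler_nat R) natrM natrD in A4.
by have := halfE _ s0; have := halfE _ ns0; lra.
Qed.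

End AngleTriples.

(** * Chains *)

Section Chains.
Variable R : realType.

Let dotE (u v : 'rV[R]_2) : dot u v = u 0 0 * v 0 0 + u 0 1 * v 0 1.
Proof.
rewrite /dot !big_ord_recl big_ord0 addr0.
by congr (_ + _ * _); congr (_ _ _); apply: val_inj.
Qed.

Let eq_row2 (u v : 'rV[R]_2) : u 0 0 = v 0 0 -> u 0 1 = v 0 1 -> u = v.
Proof.
move=> e0 e1; apply/rowP => -[[|[|//]] h].
  by rewrite (_ : Ordinal h = 0) //; apply: val_inj.
by rewrite (_ : Ordinal h = 1) //; apply: val_inj.
Qed.

Let dot_gt0 (u : 'rV[R]_2) : u != 0 -> 0 < dot u u.
Proof.
move=> u0; rewrite dotE -!expr2 lt0r addr_ge0 ?sqr_ge0// andbT.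
apply: contra_neq u0 => /eqP.
rewrite paddr_eq0 ?sqr_ge0// !sqrf_eq0 => /andP[/eqP u00 /eqP u01].
by apply: eq_row2; rewrite mxE.
Qed.

(** By Lagrange's identity |u|^2 |v|^2 = dot^2 + det^2, the argument of [acos] lies in [-1, 1] and
    the squared sine is det^2 / (|u|^2 |v|^2). Squares appear because the angle is unoriented; their
    roots give the two signs in [angle_turn]. *)
Lemma angle_det_dot (x y z : 'rV[R]_2) a : x != y -> z != y -> angle x y z = a ->
  let u := x - y in let v := z - y in
  (cos a * (u 0 0 * v 0 1 - u 0 1 * v 0 0)) ^+ 2 = (sin a * dot u v) ^+ 2.
Proof.
move=> xy zy <- u v; rewrite /angle /eucl_norm -/u -/v.
have u0 : 0 < dot u u by rewrite dot_gt0// subr_eq0.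
have v0 : 0 < dot v v by rewrite dot_gt0// subr_eq0.
set P := Num.sqrt _ * _.
have P0 : 0 < P by rewrite mulr_gt0// sqrtr_gt0.
have P2 : P ^+ 2 = dot u u * dot v v by rewrite exprMn !sqr_sqrtr// ltW.
have lagrange : P ^+ 2 = dot u v ^+ 2 + (u 0 0 * v 0 1 - u 0 1 * v 0 0) ^+ 2.
  by rewrite P2 !dotE; ring.
have DP : -1 <= dot u v / P <= 1.
  rewrite -ler_norml normrM normfV ler_pdivrMr ?normr_gt0 ?gt_eqF//.
  rewrite mul1r -ler_sqr ?nnegrE// !real_normK ?num_real// lagrange.
  by rewrite lerDl sqr_ge0.
rewrite exprMn [RHS]exprMn sin2cos2 acosK ?in_itv//=.
have -> : 1 - (dot u v / P) ^+ 2 =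
    (u 0 0 * v 0 1 - u 0 1 * v 0 0) ^+ 2 / P ^+ 2.
  rewrite expr_div_n -{1}(mulfV (_ : P ^+ 2 != 0)) ?expf_neq0 ?gt_eqF//.
  by rewrite -mulrBl lagrange addrAC subrr add0r.
by rewrite expr_div_n; ring.
Qed.

Variable E : {fset 'rV[R]_2}.

Let X (v : E) : R := val v 0 0.
Let Y (v : E) : R := val v 0 1.

Let XY_inj v w : X v = X w -> Y v = Y w -> v = w.
Proof. by move=> *; apply: val_inj; apply: eq_row2. Qed.

Lemma angle_turn (x y z : E) a : val x != val y -> val y != val z ->
  angle (val x) (val y) (val z) == a ->
  turn X Y (cos a) (sin a) x y z || turn X Y (cos a) (- sin a) x y z.
Proof.
move=> xy; rewrite eq_sym => zy /eqP ang.
have := angle_det_dot xy zy ang; rewrite /= => /eqP.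
rewrite eqf_sqr dotE !mxE /turn.
by rewrite -!(inj_eq val_inj) xy zy mulNr.
Qed.

Lemma Lambda_angle k (alpha : 'I_k -> R) (x : {ffun 'I_k.+2 -> E}) (j : 'I_k) :
  x \in Lambda E alpha ->
  turn X Y (cos (alpha j)) (sin (alpha j))
    (x (inord j)) (x (inord j.+1)) (x (inord j.+2)) ||
  turn X Y (cos (alpha j)) (- sin (alpha j))
    (x (inord j)) (x (inord j.+1)) (x (inord j.+2)).
Proof.
by rewrite inE => /forallP/(_ j)/and3P[xy yz ang]; apply: angle_turn.
Qed.

Lemma card_Lambda0 (alpha : 'I_0 -> R) : (#|Lambda E alpha| <= #|` E| ^ 2)%N.
Proof.
by apply: leq_trans (max_card _) _; rewrite card_ffun card_ord cardfE.
Qed.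

Lemma card_Lambda1 (alpha : 'I_1 -> R) : 0 < alpha ord0 < pi -> (1 < #|` E|)%N ->
  #|Lambda E alpha|%:R <=
  4 * 13824 * (#|` E|%:R ^+ 2 * ln #|` E|%:R) :> R.
Proof.
move=> /sin_gt0_pi s0; rewrite cardfE => n1.
apply: le_trans (card_turn_triples XY_inj (cos (alpha ord0)) (lt0r_neq0 s0) n1).
rewrite ler_nat.
apply: (@leq_card_rel _ _ _ _
  (fun (x : {ffun 'I_3 -> E}) p =>
     p == (x (inord 0), x (inord 1), x (inord 2)))) => [x xL|].
  exists (x (inord 0), x (inord 1), x (inord 2)); rewrite // inE.
  exact: (Lambda_angle ord0 xL).
move=> x x' p _ _ /eqP -> /eqP[e0 e1 e2]; apply/ffunP => i.
by rewrite -(inord_val i); case: i => -[|[|[|//]]] /= _.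
Qed.

Lemma card_Lambda_step k (alpha : 'I_k.+2 -> R) :
  (forall j, 0 < alpha j < pi) ->
  (#|Lambda E alpha| <= 4 * #|` E| *
     #|Lambda E (fun j : 'I_k => alpha (widen_ord (leqW (leqnSn k)) j))|)%N.
Proof.
move=> alpha_pi.
pose beta (j : 'I_k) := alpha (widen_ord (leqW (leqnSn k)) j); rewrite -/beta.
pose w2 n : (n <= n.+2)%N := leqW (leqnSn n).
pose j0 : 'I_k.+2 := inord k; pose j1 : 'I_k.+2 := inord k.+1.
have j0E : j0 = k :> nat by rewrite inordK.
have j1E : j1 = k.+1 :> nat by rewrite inordK.
pose sign (x : {ffun 'I_k.+4 -> E}) (j : 'I_k.+2) :=
  turn X Y (cos (alpha j)) (sin (alpha j))
    (x (inord j)) (x (inord j.+1)) (x (inord j.+2)).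
pose init (x : {ffun 'I_k.+4 -> E}) : {ffun 'I_k.+2 -> E} :=
  [ffun i => x (widen_ord (w2 _) i)].
have initE x j : (j < k.+2)%N -> init x (inord j) = x (inord j).
  move=> jk; rewrite ffunE; congr (x _); apply: val_inj.
  by rewrite /= !inordK// ltnW// ltnW.
(* Two orientations and the last point account for the factor 4 n; only the point with index k + 2
   is left to recover. *)
pose code x := ((sign x j0, sign x j1), x ord_max, init x).
have -> : (4 * #|` E| * #|Lambda E beta| =
    #|setX [set: (bool * bool) * E] (Lambda E beta)|)%N.
  by rewrite cardsX cardsT !card_prod !card_bool cardfE.
rewrite -(card_in_imset (f := code) (D := mem (Lambda E alpha))).
  apply/subset_leq_card/subsetP => _ /imsetP[x + ->].
  rewrite in_setX in_setT [_ \in Lambda E alpha]inE inE => /forallP xL.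
  apply/forallP => j; have := xL (widen_ord (w2 k) j).
  have jk := ltn_ord j.
  by rewrite !initE ?ltnS ?(leqW (ltnW jk)) ?(ltnW jk).
move=> x x' xL x'L [s0 s1 last_eq init_eq].
have xx' j : (j < k.+2)%N -> x (inord j) = x' (inord j).
  by move=> jk; rewrite -!initE// init_eq.
have xmax : x (inord k.+3) = x' (inord k.+3).
  by rewrite (_ : inord _ = ord_max)//; apply: val_inj; rewrite /= inordK.
have turns (y : {ffun 'I_k.+4 -> E}) j : y \in Lambda E alpha ->
    turn X Y (cos (alpha j)) (if sign y j then sin (alpha j) else - sin (alpha j))
      (y (inord j)) (y (inord j.+1)) (y (inord j.+2)).
  by move=> /(Lambda_angle j); rewrite -/(sign y j); case: ifP.
have sin0 (b : bool) j : (if b then sin (alpha j) else - sin (alpha j)) != 0.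
  by case: b; rewrite ?oppr_eq0 gt_eqF// sin_gt0_pi.
have t0 := turns _ j0 xL; have t0' := turns _ j0 x'L.
have t1 := turns _ j1 xL; have t1' := turns _ j1 x'L.
rewrite j0E in t0; rewrite j1E in t1.
rewrite j0E -s0 -(xx' k)// -(xx' k.+1)// in t0'.
rewrite j1E -s1 -(xx' k.+1)// -xmax in t1'.
(* The turn at index k + 1 puts both candidates for index k + 2 on one line through that point; the
   turn towards the shared last point then leaves one. *)
have y'l := turn_line XY_inj (sin0 _ _) t0 t0'.
have xk2 : x (inord k.+2) = x' (inord k.+2).
  have /and3P[_ yx _] := t0.
  apply: (turn_apex_inj XY_inj (sin0 _ _) (line_in_lines X Y yx) _ _ _ _ t1 t1') => //;
    by rewrite ?line_memL ?line_memR.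
apply/ffunP => i; rewrite -(inord_val i).
have := ltn_ord i; rewrite !ltnS leq_eqVlt => /orP[/eqP->//|].
by rewrite ltnS leq_eqVlt => /orP[/eqP->//|]; rewrite ltnS => /xx'.
Qed.

End Chains.

Theorem theorem2p1 (R : realType) (k : nat) (hk : (1 <= k)%N)
    (alpha : 'I_k -> R) (halpha : forall j : 'I_k, 0 < alpha j < pi) :
  exists (C : R) (N : nat), 0 < C /\
    forall (n : nat) (E : {fset 'rV[R]_2}),
      (N < n)%N -> #|` E|%fset = n ->
      #|Lambda E alpha|%:R <=
        C * (if odd k then n%:R ^+ ((k - 1) %/ 2 + 2) * ln n%:R
             else n%:R ^+ (k %/ 2 + 2)).
Proof.
(* The induction descends by two: k = 0 is the base for even k, k = 1 for odd k. *)
elim/ltn_ind: k {hk} alpha halpha => -[|[|k]] IH alpha halpha.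
- exists 1, 0%N; split=> // n E _ <-.
  by rewrite mul1r -natrX ler_nat card_Lambda0.
- exists (4 * 13824), 1%N; split; first by rewrite mulr_gt0.
  move=> n E n1 nE; rewrite -nE in n1 *.
  exact: card_Lambda1.
pose beta (j : 'I_k) := alpha (widen_ord (leqW (leqnSn k)) j).
have [|C [N [C0 IHk]]] := IH k _ beta (fun j => halpha _); first exact: leqW.
exists (4 * C), N; split; first by rewrite mulr_gt0.
move=> n E Nn nE; have := card_Lambda_step E halpha.
rewrite nE -(ler_nat R) => /le_trans; apply; rewrite -/beta !natrM.
have n0 : 0 <= 4 * n%:R :> R by rewrite mulr_ge0.
apply: le_trans (ler_wpM2l n0 (IHk n E Nn nE)) _.
(* Passing from k to k + 2 keeps the parity and raises the exponent by one, which takes up the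
   factor n. *)
rewrite mulrACA -!mulrA /= negbK; do 2 rewrite ler_pM2l//.
have [k_odd|_] := boolP (odd k).
  have -> : ((k.+2 - 1) %/ 2 + 2 = ((k - 1) %/ 2 + 2).+1)%N by lia.
  by rewrite mulrA -exprS.
have -> : (k.+2 %/ 2 + 2 = (k %/ 2 + 2).+1)%N by lia.
by rewrite -exprS.
Qed.
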